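(* Let $n>k$ be positive integers. Then there exists a graph $G_{n,k}$ on $n$ vertices such that $h_k(G_{n,k})=f_0(n,k)$, where $$f_0(n,k):=\left(\left\lceil \frac{n}{k}\right\rceil-2\right)\binom{k}{2}+\binom{k+1}{2}+\binom{n-k\left(\left\lceil \frac{n}{k}\right\rceil-1\right)-1}{2}.$$ Consequently, $f(n,k)\le f_0(n,k)$.
   Context: Graphs are finite, undirected, without loops or multiple edges. For a graph $G$ and a positive integer $k$, $h_k(G)$ denotes the number of unordered pairs of (distinct) vertices of $G$ whose degrees differ by less than $k$, i.e. $|\deg(x)-\deg(y)|<k$. For positive integers $n>k$, $f(n,k)$ denotes the smallest possible value of $h_k(G)$ over all graphs $G$ on $n$ vertices. Binomial coefficients satisfy $\binom{m}{2}=m(m-1)/2$ (so $\binom{0}{2}=\binom{1}{2}=0$). *)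

(* Defs.v *)
From HB Require Import structures.
From mathcomp Require Import all_boot all_order all_algebra.

Set Implicit Arguments.
Unset Strict Implicit.
Unset Printing Implicit Defensive.

(* A simple graph is given by its set of edges, each of which is an unordered
   pair of distinct vertices; this makes the graphs on V into a finType. *)
Record sgraph (V : finType) := SGraph {
  edges : {set {set V}};
  edgesP : [forall e in edges, #|e| == 2]
}.

HB.instance Definition _ (V : finType) := [isSub for @edges V].
HB.instance Definition _ (V : finType) := [Finite of sgraph V by <:].

Fact edgeless_subproof (V : finType) :
  [forall e in (set0 : {set {set V}}), #|e| == 2].
Proof. by apply/forall_inP => e; rewrite in_set0. Qed.

Definition edgeless (V : finType) : sgraph V := SGraph (edgeless_subproof V).

Definition adj (V : finType) (G : sgraph V) : rel V :=
  fun x y => [set x; y] \in edges G.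

Definition deg (V : finType) (G : sgraph V) (x : V) : nat :=
  #|[set y | adj G x y]|.

(* The absolute difference is taken in int. *)
Definition h (k : nat) (V : finType) (G : sgraph V) : nat :=
  #|[set e : {set V} | [exists x, exists y,
      [&& x != y, e == [set x; y]
        & (`|(deg G x)%:Z - (deg G y)%:Z| < k%:Z)%R]]]|.

(* The graphs on n vertices are taken on 'I_n, h being invariant under
   isomorphism; the edgeless graph only witnesses that there is one. *)
Definition f (n k : nat) : nat :=
  h k [arg min_(G < edgeless 'I_n) h k G].

Definition ceil_div (n k : nat) : nat :=
  `|Num.ceil (n%:R / k%:R : rat)%R|%N.

(* When 0 < k < n, ceil_div n k >= 2 and k * (ceil_div n k - 1) + 1 <= n, so
   the truncated subtractions are the true ones. *)
Definition f0 (n k : nat) : nat :=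
  (ceil_div n k - 2) * 'C(k, 2) + 'C(k + 1, 2)
  + 'C(n - k * (ceil_div n k - 1) - 1, 2).

(* Main.v *)
Require Import Defs.
From mathcomp Require Import all_boot all_order all_algebra.
From mathcomp Require Import zify.

Set Implicit Arguments.
Unset Strict Implicit.
Unset Printing Implicit Defensive.

(** Write m = ceil (n / k) - 1. Split the n vertices into levels 0, ..., m, each
    of size k except that the middle level floor (m / 2) has k + 1 vertices and
    the top level has the n - k * m - 1 >= 0 that remain. Join two distinct
    vertices when their levels add up to at least m. This blown-up half graph
    attains f0: its degrees are constant on levels and jump by at least k from
    one level to the next, so the pairs counted by h k are those inside a level,
    and the sum of 'C(size, 2) over the levels is f0.

    The jumps come from nested neighbourhoods. If loops were allowed, then moving
    from level i up to level i + 1 would add exactly the level m - i - 1 to the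
    neighbourhood, and this level is below the top, hence has at least k
    vertices. Excluding loops lowers the degree by one on the levels i with
    m <= 2i, so that one jump, the one that enters this upper half, loses one.
    The level added at that jump is the middle one, whose extra vertex makes up
    for the loss ([deg_sum_graph_gap]). The rest is counting: [h_sum_graph] turns
    h k into a sum over levels, [card_block_level] gives the size of each level
    for an explicit assignment of levels to 'I_n, and [ceil_divE] translates the
    rational ceiling into Euclidean division. *)

Definition level (V : finType) (g : V -> nat) (i : nat) : {set V} :=
  [set y | g y == i].

Lemma card_monochromatic_pairs (V : finType) (m : nat) (g : V -> nat) :
    (forall x, g x < m) ->
  #|[set e : {set V} | [exists x, exists y,
      [&& x != y, e == [set x; y] & g x == g y]]]|
  = \sum_(i < m) 'C(#|level g i|, 2).
Proof.
move=> ltgm; set S := [set e | _].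
(* The colour of a pair is the maximum of the colours of its ends, so that it
   can be written without choosing an end. *)
pose col (e : {set V}) := \max_(x in e) g x.
have colE x y : g x = g y -> col [set x; y] = g y.
  move=> gxy; have [->|neq] := eqVneq x y; first by rewrite setUid /col big_set1.
  by rewrite /col big_setU1 ?inE // big_set1 /= gxy maxnn.
case: m ltgm => [|m] ltgm.
  rewrite big_ord0; apply/eqP; rewrite cards_eq0; apply/eqP/setP=> e.
  by rewrite !inE; apply/existsP => -[x _]; have:= ltgm x.
rewrite -sum1_card (partition_big (fun e => inord (col e) : 'I_m.+1) predT) //=.
apply: eq_bigr => i _; rewrite sum1dep_card -cards_draws; congr #|pred_of_set _|.
apply/setP => e; rewrite !inE; apply/andP/andP.
  case=> /existsP[x /existsP[y /and3P[neq /eqP-> /eqP gxy]]].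
  rewrite colE // -val_eqE /= inordK // => /eqP gy; rewrite cards2 neq; split=> //.
  by apply/subsetP => z; rewrite !inE => /orP[] /eqP->; rewrite ?gxy gy.
case=> sub /cards2P[x [y [neq def_e]]]; subst e; move/subsetP: sub => sub.
have /eqP gx : g x == i by have:= sub x; rewrite !inE eqxx; apply.
have /eqP gy : g y == i by have:= sub y; rewrite !inE eqxx orbT; apply.
split; last by rewrite colE ?gx // gy inord_val.
by apply/existsP; exists x; apply/existsP; exists y; rewrite neq eqxx gx gy eqxx.
Qed.

(** The graph is kept abstract here: any level function g : V -> nat defines one,
    and only the sizes of its levels matter for the degrees. *)
Section SumGraph.

Variables (V : finType) (g : V -> nat) (m : nat).

Definition sum_edges : {set {set V}} :=
  [set e : {set V} | [exists x, exists y,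
     [&& x != y, e == [set x; y] & m <= g x + g y]]].

Fact sum_edgesP : [forall e in sum_edges, #|e| == 2].
Proof.
apply/forall_inP=> e; rewrite inE.
by case/existsP=> x /existsP[y /and3P[neq /eqP-> _]]; rewrite cards2 neq.
Qed.

Definition sum_graph : sgraph V := SGraph sum_edgesP.

Lemma adj_sum_graph x y : adj sum_graph x y = (x != y) && (m <= g x + g y).
Proof.
rewrite /adj inE; apply/existsP/andP=> [[u /existsP[v /and3P[neq]]]|[neq le]].
  move/eqP=> eqe le; have card2 : #|[set x; y]| = 2 by rewrite eqe cards2 neq.
  split; first by move: card2; rewrite cards2; case: (x != y).
  have: x \in [set u; v] by rewrite -eqe !inE eqxx.
  have: y \in [set u; v] by rewrite -eqe !inE eqxx orbT.
  move: card2; rewrite cards2 !inE.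
  case: eqVneq => // nxy _ /orP[]/eqP ? /orP[]/eqP ?; subst x y;
    by rewrite ?eqxx // addnC in nxy *.
by exists x; apply/existsP; exists y; rewrite neq eqxx.
Qed.

(** Counting x as its own neighbour when m <= 2 * g x makes the neighbourhoods
    nested and increasing in g x, which the true neighbourhoods are not. *)
Lemma deg_sum_graph x :
  deg sum_graph x + (m <= g x + g x) = #|[set y | m <= g x + g y]|.
Proof.
rewrite [RHS](cardsD1 x) inE addnC /deg; congr (_ + #|pred_of_set _|).
by apply/setP=> y; rewrite !inE adj_sum_graph eq_sym.
Qed.

(** The neighbourhoods with loops differ by the levels in [m - g y, m - g x),
    among them m - g x - 1, which supplies k vertices. The bonus vertex of level
    m./2 is needed only if y has a loop and x has none, and exactly then m./2 lies
    in that interval. *)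
Lemma deg_sum_graph_gap k :
    (forall x, g x <= m) ->
    (forall i, i < m -> k + (i == m./2) <= #|level g i|) ->
  forall x y, g x < g y -> deg sum_graph x + k <= deg sum_graph y.
Proof.
move=> legm lek x y lt_xy.
have leym := legm y.
have lt_im : m - (g x).+1 < m by lia.
(* The loss in degree from excluding loops; it is 0 or 1. *)
set c := (m <= g y + g y) - (m <= g x + g x).
suff: #|[set z | m <= g x + g z]| + (k + c) <= #|[set z | m <= g y + g z]|.
  by rewrite -!deg_sum_graph /c; lia.
pose D := [set z | m - g y <= g z < m - g x].
have -> : [set z | m <= g y + g z] = [set z | m <= g x + g z] :|: D.
  by apply/setP=> z; rewrite !inE; lia.
have -> : #|[set z | m <= g x + g z] :|: D| = #|[set z | m <= g x + g z]| + #|D|.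
  apply/eqP; rewrite (leq_card_setU _ D) -setI_eq0; apply/eqP/setP=> z.
  by rewrite !inE; lia.
rewrite leq_add2l.
have subD i : m - g y <= i < m - g x -> level g i \subset D.
  by move=> ltD; apply/subsetP=> z; rewrite !inE => /eqP->.
have lev1 := lek _ lt_im.
have sub1 : level g (m - (g x).+1) \subset D by apply: subD; lia.
have [eq_mid|neq_mid] := eqVneq (m - (g x).+1) m./2.
  apply: leq_trans (subset_leq_card sub1); move: lev1.
  by rewrite eq_mid eqxx /c; lia.
have [c0|c_gt0] := posnP c.
  by rewrite c0; have:= subset_leq_card sub1; lia.
(* The middle level lies in D but is not the level used so far, so any one of
   its vertices covers the loss. *)
have mid_lt : m./2 < m by lia.
have sub2 : level g m./2 \subset D by apply: subD; rewrite /c in c_gt0; lia.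
have lev2 := lek _ mid_lt; rewrite eqxx in lev2.
have: level g (m - (g x).+1) :|: level g m./2 \subset D by rewrite subUset sub1.
move/subset_leq_card; apply: leq_trans.
have /eqP-> : #|level g (m - (g x).+1) :|: level g m./2|
    == #|level g (m - (g x).+1)| + #|level g m./2|.
  rewrite (leq_card_setU _ (level g m./2)) -setI_eq0; apply/eqP/setP=> z.
  by rewrite !inE; apply/andP=> -[/eqP-> /eqP eq_mid]; rewrite eq_mid eqxx in neq_mid.
by rewrite /c; lia.
Qed.

(** Equal levels force equal degrees, and distinct levels force degrees at least
    k apart, so closeness of degrees is the relation of lying in one level. *)
Lemma h_sum_graph k :
    0 < k -> (forall x, g x <= m) ->
    (forall i, i < m -> k + (i == m./2) <= #|level g i|) ->
  h k sum_graph = \sum_(i < m.+1) 'C(#|level g i|, 2).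
Proof.
move=> k_gt0 legm lek; rewrite -card_monochromatic_pairs // /h.
have gap := deg_sum_graph_gap legm lek.
congr #|pred_of_set _|; apply/setP=> e; rewrite !inE.
apply: eq_existsb => x; apply: eq_existsb => y; congr [&& _, _ & _].
have [lt_xy|lt_yx|eq_xy] := ltngtP (g x) (g y).
- by have:= gap _ _ lt_xy; lia.
- by have:= gap _ _ lt_yx; lia.
suff -> : deg sum_graph x = deg sum_graph y by lia.
by have:= deg_sum_graph x; have:= deg_sum_graph y; rewrite eq_xy; lia.
Qed.

End SumGraph.

Lemma card_ord_between N a b : #|[set y : 'I_N | a <= y < b]| = minn N b - a.
Proof.
rewrite -sum1dep_card -(big_mkord (fun y => a <= y < b) (fun=> 1)) /=.
rewrite [RHS](_ : _ = \sum_(a <= y < minn N b) 1); last first.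
  by rewrite sum_nat_const_nat muln1.
rewrite [RHS](big_nat_widen _ _ N) ?geq_minl // [RHS](big_nat_widenl _ 0) //=.
by apply: congr_big_nat => // y ltyN; lia.
Qed.

(** Vertex 0 is the extra vertex of the middle level; the other vertices are cut
    into consecutive blocks of k. *)
Definition block_index (k m x : nat) : nat :=
  if x == 0 then m./2 else x.-1 %/ k.

Lemma card_block_level n k m (i : nat) :
    0 < k -> k * m < n -> n <= k * m.+1 -> i <= m ->
  #|level (fun x : 'I_n => block_index k m x) i|
  = (i == m./2) + (if i < m then k else n - k * m - 1).
Proof.
move=> k_gt0 lt_n le_n lim; case: n lt_n le_n => // n lt_n le_n.
rewrite (cardsD1 ord0) inE /block_index eqxx eq_sym; congr (_ + _).
transitivity #|[set y : 'I_n.+1 | i * k + 1 <= y < i.+1 * k + 1]|.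
  congr #|pred_of_set _|; apply/setP=> y; rewrite !inE -val_eqE /=.
  case: (nat_of_ord y) => [|z] /=; first by rewrite addn1.
  by rewrite eqn_leq leq_divRL // -ltnS ltn_divLR // !addn1 !ltnS andbC.
rewrite card_ord_between; case: ltnP => [lt_im|le_mi].
  suff: i.+1 * k + 1 <= n.+1 by move/minn_idPr->; rewrite mulSn; lia.
  by have: i.+1 * k <= m * k by [rewrite leq_mul2r lt_im orbT]; lia.
have -> : i = m by lia.
by rewrite mulSn; lia.
Qed.

Lemma ceil_divE n k : 0 < k -> 0 < n -> ceil_div n k = (n.-1 %/ k).+1.
Proof.
move=> k_gt0 n_gt0; rewrite /ceil_div.
suff -> : Num.ceil (n%:R / k%:R : rat)%R = Posz (n.-1 %/ k).+1 by [].
have k0 : (0 < k%:R :> rat)%R by rewrite Num.Theory.ltr0n.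
apply: Num.Theory.ceil_def; apply/andP; split.
  rewrite Num.Theory.ltr_pdivlMr // -[X in (_ - X)%R]/(Posz 1) subzn //.
  rewrite -pmulrn -GRing.natrM Num.Theory.ltr_nat subn1 /=.
  by have:= leq_divM n.-1 k; lia.
rewrite Num.Theory.ler_pdivrMr // -pmulrn -GRing.natrM Num.Theory.ler_nat.
by have:= ltn_ceil n.-1 k_gt0; lia.
Qed.

Theorem theorem1 (n k : nat) (k_gt0 : 0 < k) (lt_kn : k < n) :
  (exists G : sgraph 'I_n, h k G = f0 n k) /\ f n k <= f0 n k.
Proof.
suff exG : exists G : sgraph 'I_n, h k G = f0 n k.
  split=> //; case: exG => G <-; rewrite /f.
  by case: arg_minnP => [//|G0 _ minG0]; exact: minG0.
have n_gt0 : 0 < n by lia.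
pose m := n.-1 %/ k.
have m_gt0 : 0 < m by rewrite divn_gt0 //; lia.
have lt_n : k * m < n by have:= leq_divM n.-1 k; rewrite -/m; lia.
have le_n : n <= k * m.+1 by have:= ltn_ceil n.-1 k_gt0; rewrite -/m; lia.
exists (sum_graph (fun x : 'I_n => block_index k m x) m).
rewrite h_sum_graph //.
- have level_size (i : 'I_m.+1) := card_block_level k_gt0 lt_n le_n (ltn_ord i).
  under eq_bigr => i _ do rewrite level_size.
  have mid : m./2 < m by lia.
  rewrite big_ord_recr /= ltnn gtn_eqF // add0n.
  rewrite (bigD1 (Ordinal mid)) //= eqxx mid.
  rewrite (eq_bigr (fun=> 'C(k, 2))); last first.
    by move=> i neq; rewrite ltn_ord -val_eqE in neq *; rewrite (negPf neq).
  rewrite sum_nat_const cardC1 card_ord /f0 ceil_divE // -/m.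
  by rewrite subSS !subn1 /= [1 + k]addnC [X in X + _ = _]addnC.
- move=> x; rewrite /block_index; case: eqP => _; first by lia.
  by apply: leq_div2r; have:= ltn_ord x; lia.
by move=> i lt_im; rewrite card_block_level ?(ltnW lt_im) // lt_im addnC.
Qed.
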